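(* For the Hadamard walk on $\mathbb{Z}$, let $\Gamma_{2n}(2k)$ be the sum of the weights of all $2n$-step paths from the origin to the origin that spend exactly $2k$ time intervals to the right of the origin (see context), and let $$\bar\Gamma(z,t)=\sum_{k=0}^{\infty}\sum_{n=1}^{\infty}\Gamma_{2n}(2k)\,z^{2n}t^{2k}.$$ Put $A=\sqrt{1+z^4}$, $B=\sqrt{1+z^4t^4}$ (the power series with constant term $1$) and $C=-1-(z^2-A)(z^2t^2-B)$. Then, as formal power series in $z,t$, $$\bar\Gamma(z,t)=\frac1C\begin{bmatrix}(z^2-A)(1+z^2t^2-B)&1+z^2t^2-B\\-1-z^2+A&-(-1-z^2+A)(z^2t^2-B)\end{bmatrix}.$$
   Context: Hadamard walk: put $$P=\tfrac1{\sqrt2}\begin{bmatrix}1&1\\0&0\end{bmatrix},\quad Q=\tfrac1{\sqrt2}\begin{bmatrix}0&0\\1&-1\end{bmatrix}.$$ $P$ represents a step to the left and $Q$ a step to the right. Paths: a nearest-neighbour path $(x_0,x_1,\dots,x_n)$ in $\mathbb{Z}$ (so $|x_i-x_{i-1}|=1$) has weight the matrix product $M_nM_{n-1}\cdots M_1$, where $M_i=P$ if $x_i=x_{i-1}-1$ and $M_i=Q$ if $x_i=x_{i-1}+1$ (the first step is the rightmost factor). The $i$-th time interval is spent to the right of the origin if the edge $\{x_{i-1},x_i\}$ lies in $\{0,1,2,\dots\}$, i.e. $\max(x_{i-1},x_i)\ge1$. $\Gamma_n(k)$ is the sum of the weights of all $n$-step paths with $x_0=x_n=0$ that spend exactly $k$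 of the $n$ time intervals to the right of the origin (the zero matrix if there are none). E.g. $\Gamma_2(0)=QP$, $\Gamma_2(2)=PQ$, $\Gamma_4(2)=QP^2Q+PQ^2P$. *)

(* Defs.v *)
From HB Require Import structures.
From mathcomp Require Import all_boot all_order all_algebra.
From mathcomp Require Import boolp classical_sets.

Set Implicit Arguments.
Unset Strict Implicit.
Unset Printing Implicit Defensive.

Import Order.TTheory GRing.Theory Num.Theory.
Local Open Scope ring_scope.

(* Formal power series in one variable.  A record is used so that the Cauchy
   product does not clash with the pointwise ring structure on functions.
   Series in z and t are elements of {fps {fps R}} = R[[t]][[z]]: the
   coefficient of z^m t^l in f is f m l. *)
Record fps (R : Type) := Fps { coefs :> nat -> R }.

Notation "{ 'fps' R }" := (fps R) (at level 0, format "{ 'fps'  R }").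

HB.instance Definition _ (R : Type) := gen_eqMixin {fps R}.
HB.instance Definition _ (R : Type) := gen_choiceMixin {fps R}.

Lemma fpsP (R : Type) (f g : {fps R}) : f =1 g <-> f = g.
Proof.
split=> [|-> //]; case: f g => f [g] /= fg; congr Fps; exact: funext.
Qed.

Section FpsRing.
Variable R : comNzRingType.
Implicit Types f g h : {fps R}.

Definition fps_const (a : R) : {fps R} :=
  Fps (fun n => if n == 0%N then a else 0).
Definition fps_X : {fps R} := Fps (fun n => (n == 1%N)%:R).
Definition fps_opp f : {fps R} := Fps (fun n => - f n).
Definition fps_add f g : {fps R} := Fps (fun n => f n + g n).
Definition fps_mul f g : {fps R} :=
  Fps (fun n => \sum_(i < n.+1) f i * g (n - i)%N).

Fact fps_addA : associative fps_add.
Proof. by move=> f g h; apply/fpsP => n /=; rewrite addrA. Qed.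

Fact fps_addC : commutative fps_add.
Proof. by move=> f g; apply/fpsP => n /=; rewrite addrC. Qed.

Fact fps_add0 : left_id (fps_const 0) fps_add.
Proof. by move=> f; apply/fpsP => n /=; rewrite if_same add0r. Qed.

Fact fps_addN : left_inverse (fps_const 0) fps_opp fps_add.
Proof. by move=> f; apply/fpsP => n /=; rewrite if_same addNr. Qed.

HB.instance Definition _ :=
  GRing.isZmodule.Build {fps R} fps_addA fps_addC fps_add0 fps_addN.

Definition fps_trunc N f : {poly R} := \poly_(i < N) f i.

Lemma coef_fps_mul N f g n : (n < N)%N ->
  fps_mul f g n = (fps_trunc N f * fps_trunc N g)`_n.
Proof.
move=> nN; rewrite coefM; apply: eq_bigr => i _; rewrite !coef_poly.
by rewrite (leq_ltn_trans _ nN) ?leq_ord // (leq_ltn_trans _ nN) ?leq_subr.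
Qed.

Fact fps_mulC : commutative fps_mul.
Proof.
by move=> f g; apply/fpsP => n; rewrite !(@coef_fps_mul n.+1) // mulrC.
Qed.

Fact fps_mulA : associative fps_mul.
Proof.
move=> f g h; apply/fpsP => n.
transitivity (fps_trunc n.+1 f * fps_trunc n.+1 g * fps_trunc n.+1 h)`_n.
  rewrite -mulrA coefM; apply: eq_bigr => i _.
  by rewrite coef_poly ltn_ord (@coef_fps_mul n.+1) // ltnS leq_subr.
rewrite coefM; apply: eq_bigr => i _.
by rewrite coef_poly ltnS leq_subr (@coef_fps_mul n.+1).
Qed.

Fact fps_mul1 : left_id (fps_const 1) fps_mul.
Proof.
move=> f; apply/fpsP => n /=; rewrite big_ord_recl /= mul1r subn0.
by rewrite big1 ?addr0 // => i _; rewrite mul0r.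
Qed.

Fact fps_mulDl : left_distributive fps_mul fps_add.
Proof.
move=> f g h; apply/fpsP => n /=; rewrite -big_split /=.
by apply: eq_bigr => i _; rewrite mulrDl.
Qed.

Fact fps_1neq0 : fps_const 1 != 0 :> {fps R}.
Proof.
by apply/eqP => /fpsP /(_ 0%N) /= /eqP; rewrite oner_eq0.
Qed.

HB.instance Definition _ := GRing.Zmodule_isComNzRing.Build {fps R}
  fps_mulA fps_mulC fps_mul1 fps_mulDl fps_1neq0.

(* The inverse of f is the series g with g * f = 1 when there is one; by the
   MathComp convention it is f itself otherwise. *)
Definition fps_unit : {pred {fps R}} := fun f => `[< exists g, g * f = 1 >].
Definition fps_inv f : {fps R} := xget f [set g | g * f = 1].

Fact fps_mulV : {in fps_unit, left_inverse 1 fps_inv *%R}.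
Proof. by move=> f /asboolP; exact: xgetPex. Qed.

Fact fps_unitP f g : g * f = 1 -> fps_unit f.
Proof. by move=> gf; apply/asboolP; exists g. Qed.

Fact fps_inv_out : {in [predC fps_unit], fps_inv =1 id}.
Proof.
by move=> f /negP nf; apply: xgetPN => g gf; apply: nf; apply: fps_unitP gf.
Qed.

HB.instance Definition _ := GRing.ComNzRing_hasMulInverse.Build {fps R}
  fps_mulV fps_unitP fps_inv_out.

End FpsRing.

(* The square root of a series in two variables which has constant term 1. *)
Definition fps2_sqrt (R : comNzRingType) (f : {fps {fps R}}) : {fps {fps R}} :=
  xget 0 [set g : {fps {fps R}} | g ^+ 2 = f /\ g 0%N 0%N = 1].

Definition mx2 (S : Type) (a b c d : S) : 'M[S]_2 :=
  \matrix_(i, j) if i == 0 then (if j == 0 then a else b)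
                 else (if j == 0 then c else d).

Section HadamardWalk.
Variable R : rcfType.

Definition hadamardP : 'M[R]_2 := (Num.sqrt 2)^-1 *: mx2 1 1 0 0.
Definition hadamardQ : 'M[R]_2 := (Num.sqrt 2)^-1 *: mx2 0 0 1 (-1).

(* A nearest-neighbour path from the origin is encoded by its sequence of
   steps, [true] being a step to the right and [false] a step to the left. *)

Definition position (s : seq bool) (i : nat) : int :=
  \sum_(b <- take i s) (if b then 1 else -1).

(* M_n ... M_1, where n is the length of s: hence the reversal. *)
Definition weight (s : seq bool) : 'M[R]_2 :=
  \prod_(b <- rev s) (if b then hadamardQ else hadamardP).

(* The interval from time i to time i.+1 is spent to the right of the origin
   when the edge between the two positions lies in {0, 1, 2, ...}. *)
Definition time_right (s : seq bool) : nat :=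
  count (fun i => 1 <= Num.max (position s i) (position s i.+1))
        (iota 0 (size s)).

Definition Gamma (n k : nat) : 'M[R]_2 :=
  \sum_(s : n.-tuple bool | (position s n == 0) && (time_right s == k))
    weight s.

(* The coefficient of z^m t^l is Gamma m l if m = 2n with n >= 1 and l = 2k,
   and 0 otherwise. *)
Definition Gammabar : 'M[{fps {fps R}}]_2 :=
  \matrix_(i, j) Fps (fun m => Fps (fun l =>
    if [&& (0 < m)%N, ~~ odd m & ~~ odd l] then Gamma m l i j else 0)).

End HadamardWalk.

(* Main.v *)
Require Import Defs.
From mathcomp Require Import all_boot all_order all_algebra.
From mathcomp Require Import boolp classical_sets ring zify.
Import Order.TTheory GRing.Theory Num.Theory.
Local Open Scope ring_scope.

(** Let G_x be the generating series of the weights of all paths from 0 to x,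
    and (a_x, b_x) a column of G_x.  With r = z/sqrt 2 and s = z t/sqrt 2,
    splitting off the last step gives
      a_x = [x = 0] x0 + s_x (a_{x+1} + b_{x+1}),
      b_x = [x = 0] y0 + s_{x-1} (a_{x-1} - b_{x-1}),
    where s_x is s for x >= 0 and r for x < 0.  This system has only one
    solution in power series, as the coefficients of z^{m+1} are determined by
    those of z^m.  A solution which is geometric on each half-line,
    (a_x, b_x) = l^{x-1} (a_1, b_1) for x >= 1, requires
      l (1 - s l) = s (2 s l - 1), i.e. 2 s l = 1 - z^2 t^2 - B,
    and similarly on the left with A; what remains at x = 0 is a linear 2 x 2
    system for G_0 = 1 + Gammabar, of determinant - C / 2. *)

(** * Inverses and square roots of power series by recursion on coefficients *)

(** The value at n of the iterates of [Phi] is stable from the iterate n + 1 on, because it depends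
    on earlier values only; the stable values form the fixed point. *)
Lemma causal_fixpoint (T : Type) (x0 : T) (Phi : (nat -> T) -> nat -> T) :
  (forall g h n, (forall i, (i < n)%N -> g i = h i) -> Phi g n = Phi h n) ->
  exists g : nat -> T, forall n, g n = Phi g n.
Proof.
move=> causal; pose u k := iter k Phi (fun=> x0).
have uS k n : (n < k)%N -> u k n = u k.+1 n.
  elim: k n => // k IHk n nk /=; apply: causal => i lt_in.
  by apply: IHk; apply: leq_trans lt_in _.
have ule j n : u n.+1 n = u (n.+1 + j)%N n.
  by elim: j => [|j ->]; rewrite ?addn0 // addnS -uS // ltnS leq_addr.
exists (fun n => u n.+1 n) => n /=; apply: causal => i lt_in.
by rewrite -[RHS]/(u i.+1 i) (ule (n - i.+1)%N) subnKC.
Qed.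

Section Coefficients.
Variable R : comNzRingType.
Implicit Types f g : {fps R}.

Lemma coef_fpsD f g n : (f + g) n = f n + g n. Proof. by []. Qed.
Lemma coef_fpsN f n : (- f) n = - f n. Proof. by []. Qed.
Lemma coef_fps0 n : (0 : {fps R}) n = 0. Proof. exact: if_same. Qed.
Lemma coef_fps1 n : (1 : {fps R}) n = (n == 0%N)%:R. Proof. by case: n. Qed.
Lemma coef_fpsM f g n : (f * g) n = \sum_(i < n.+1) f i * g (n - i)%N.
Proof. by []. Qed.

Lemma coef0_fpsM f g : (f * g) 0%N = f 0%N * g 0%N.
Proof. by rewrite coef_fpsM big_ord1. Qed.

Lemma coef_fpsCM c f n : (fps_const c * f) n = c * f n.
Proof.
rewrite coef_fpsM big_ord_recl /= subn0 big1 ?addr0 // => i _.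
by rewrite mul0r.
Qed.

Lemma coef_fpsXM f n : (fps_X R * f) n = if n is k.+1 then f k else 0.
Proof.
case: n => [|n]; first by rewrite coef0_fpsM mul0r.
rewrite coef_fpsM 2!big_ord_recl big1 /= => [|i _]; last by rewrite mul0r.
by rewrite mul0r mul1r add0r addr0 subn1.
Qed.

Lemma fps_constM (a b : R) : fps_const (a * b) = fps_const a * fps_const b.
Proof. by apply/fpsP => n; rewrite coef_fpsCM /=; case: eqP; rewrite ?mulr0. Qed.

Lemma fps_constX (a : R) n : fps_const (a ^+ n) = fps_const a ^+ n.
Proof. by elim: n => // n IHn; rewrite !exprS fps_constM IHn. Qed.

Lemma fps_const_natr k : fps_const k%:R = k%:R :> {fps R}.
Proof.
elim: k => // k IHk; rewrite !mulrS -IHk; apply/fpsP => n.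
by rewrite coef_fpsD coef_fps1 /=; case: eqP; rewrite ?addr0.
Qed.

End Coefficients.

Section Existence.
Variable R : comUnitRingType.
Implicit Types f g : {fps R}.

Lemma fps_unit_coef0 f : f 0%N \is a GRing.unit -> f \is a GRing.unit.
Proof.
(* This is the coefficient of index n in f g = 1, solved for g_n. *)
move=> f0; pose Phi (g : nat -> R) n :=
  (f 0%N)^-1 * ((n == 0%N)%:R - \sum_(i < n) f i.+1 * g (n - i.+1)%N).
have [|g gP] := @causal_fixpoint R 0 Phi.
  move=> g h n gh; congr (_ * (_ - _)); apply: eq_bigr => i _.
  by rewrite gh // ltn_subrL /= (leq_ltn_trans _ (ltn_ord i)).
apply/unitrP; exists (Fps g); rewrite mulrC; split; apply/fpsP => n;
  rewrite coef_fps1 coef_fpsM big_ord_recl /= subn0 gP mulrA divrr // mul1r;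
  by rewrite addrNK.
Qed.

Lemma fps_sqrt_exists f : 2%:R \is a @GRing.unit R -> f 0%N = 1 ->
  exists g, g ^+ 2 = f /\ g 0%N = 1.
Proof.
(* In the coefficient of index n of g^2 = f the unknown g_n occurs as 2 g_0 g_n with g_0 = 1; the
   other products involve g_1, ..., g_{n-1} only. *)
move=> u2 f0; pose Phi (g : nat -> R) n := if n is k.+1 then
  2%:R^-1 * (f n - \sum_(i < k) g i.+1 * g (k - i)%N) else 1.
have [|g gP] := @causal_fixpoint R 0 Phi.
  move=> g h [|n] gh //; congr (_ * (_ - _)); apply: eq_bigr => i _.
  by rewrite !gh // ltnS ?leq_subr.
exists (Fps g); split; last by rewrite /= gP.
apply/fpsP => n; rewrite expr2 coef_fpsM.
case: n => [|n]; first by rewrite big_ord1 /= gP f0 mulr1.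
rewrite big_ord_recl big_ord_recr /= subn0 subnn.
rewrite [g 0%N]gP mulr1 mul1r -[bump 0 n]/(n.+1) addrCA -mulr2n -mulr_natl.
rewrite [g n.+1]gP mulrA divrr // mul1r addrC.
exact: subrK.
Qed.

End Existence.

Section Bivariate.
Variable R : fieldType.
Implicit Types f g : {fps {fps R}}.

Lemma fps2_unit_coef00 f : f 0%N 0%N != 0 -> f \is a GRing.unit.
Proof. by move=> f0; do 2!apply: fps_unit_coef0; rewrite unitfE. Qed.

Lemma fps2_sqrtP f : 2%:R != 0 :> R -> f 0%N = 1 ->
  fps2_sqrt f ^+ 2 = f /\ fps2_sqrt f 0%N 0%N = 1.
Proof.
move=> n2 f0; have [|//|g [gg g0]] := @fps_sqrt_exists _ f.
  by apply: fps_unit_coef0; rewrite -fps_const_natr unitfE.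
apply: (@xgetPex _ 0 [set g : {fps {fps R}} | g ^+ 2 = f /\ g 0%N 0%N = 1]%classic).
by exists g; rewrite /= gg g0.
Qed.

End Bivariate.

(* The geometric ratio l and the factor p = s / (1 - s l) are
   - 2 s / (1 - 2 s^2 + B) and 2 s / (1 + 2 s^2 + B): this form of the root of
   the quadratic equation avoids dividing by s, which is not a unit. *)
Lemma half_line (K : comUnitRingType) (s B : K) :
    B ^+ 2 = 1 + (2 * s ^+ 2) ^+ 2 ->
    1 + 2 * s ^+ 2 + B \is a GRing.unit -> 1 - 2 * s ^+ 2 + B \is a GRing.unit ->
  exists l p, [/\ l * (1 - s * l) = s * (2 * (s * l) - 1),
    p * (1 - s * l) = s & 2 * (s * p) = 1 + 2 * s ^+ 2 - B].
Proof.
move=> BB /divrr uP /divrr vP.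
set u := _^-1 in uP; set v := _^-1 in vP.
exists (- (2 * s * v)), (2 * s * u).
have E : 1 - s * - (2 * s * v) = (1 + B) * v.
  transitivity ((1 - 2 * s ^+ 2 + B) * v + 2 * s ^+ 2 * v); last by ring.
  by rewrite vP; ring.
(* The two denominators multiply to (1 + B)^2 - (2 s^2)^2 = 2 (1 + B). *)
have F : 2 * ((1 + B) * (u * v)) = 1.
  transitivity ((1 + 2 * s ^+ 2 + B) * u * ((1 - 2 * s ^+ 2 + B) * v)).
    transitivity ((1 + 2 * B + B ^+ 2 - (2 * s ^+ 2) ^+ 2) * (u * v)); last by ring.
    by rewrite BB; ring.
  by rewrite uP vP mulr1.
split.
- have -> : 2 * (s * - (2 * s * v)) - 1 = - (1 + B + 2 * s ^+ 2) * v.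
    transitivity (- (4 * s ^+ 2 * v + (1 - 2 * s ^+ 2 + B) * v)); last by ring.
    by rewrite vP; ring.
  rewrite E; transitivity (- (s * v * (2 * ((1 + B) * v)))); first by ring.
  transitivity (- (s * v * (1 + B + 2 * s ^+ 2))); last by ring.
  congr (- (_ * _)).
  transitivity ((1 + B + 2 * s ^+ 2) * ((1 - 2 * s ^+ 2 + B) * v)); last by rewrite vP mulr1.
  transitivity ((1 + 2 * B + B ^+ 2 - (2 * s ^+ 2) ^+ 2) * v); last by ring.
  by rewrite BB; ring.
- rewrite E; transitivity (s * (2 * ((1 + B) * (u * v)))); first by ring.
  by rewrite F mulr1.
- transitivity ((1 + 2 * s ^+ 2 - B) * ((1 + 2 * s ^+ 2 + B) * u)).
    transitivity (((1 + 2 * s ^+ 2) ^+ 2 - B ^+ 2) * u); last by ring.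
    by rewrite BB; ring.
  by rewrite uP mulr1.
Qed.

(** * Paths and their last step *)

Definition move (b : bool) : int := if b then 1 else -1.
Definition endpoint (s : seq bool) : int := \sum_(b <- s) move b.

Lemma endpoint_rcons s b : endpoint (rcons s b) = endpoint s + move b.
Proof. by rewrite /endpoint -cats1 big_cat big_seq1. Qed.

Lemma position_size s n : n = size s -> position s n = endpoint s.
Proof. by move=> ->; rewrite /position take_size. Qed.

(** The added term tests the left end of the last edge: the edge lies to the right of the origin
    exactly when that end is nonnegative. *)
Lemma time_right_rcons s b : time_right (rcons s b) =
  (time_right s + (0 <= endpoint s + (if b then 0 else -1))%R)%N.
Proof.
have pos_rcons i : (i <= size s)%N -> position (rcons s b) i = position s i.
  by move=> le_is; rewrite /position -cats1 takel_cat.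
rewrite /time_right size_rcons -addn1 iotaD count_cat /= add0n addn0.
congr (_ + nat_of_bool _)%N.
  apply: eq_in_count => i; rewrite mem_iota /= add0n => lt_is.
  by rewrite !pos_rcons // ltnW.
rewrite pos_rcons // position_size // position_size ?size_rcons //.
rewrite endpoint_rcons /move; case: b {pos_rcons}; lia.
Qed.

(** Excursions to the right of the origin have even length. The induction needs all endpoints; at
    endpoint 0 both the length and the time on the right come out even. *)
Lemma parity s : odd (size s) = odd `|endpoint s|%N /\
  odd (time_right s) = (0 <= endpoint s) && odd `|endpoint s|%N.
Proof.
elim/last_ind: s => [|s b [IHs IHt]]; first by rewrite /endpoint big_nil.
rewrite size_rcons time_right_rcons endpoint_rcons oddD /= IHs IHt.
by rewrite /move; case: b; split; lia.
Qed.

Section Walk.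
Variable R : rcfType.
Notation q := ((Num.sqrt 2 : R)^-1).

Lemma weight_rcons s b : weight R (rcons s b) =
  (if b then hadamardQ R else hadamardP R) *m weight R s.
Proof. by rewrite /weight rev_rcons big_cons. Qed.

(** The coefficient of z^m t^l in the series G_x. *)
Definition walk_sum (m l : nat) (x : int) : 'M[R]_2 :=
  \sum_(s : m.-tuple bool | (endpoint s == x) && (time_right s == l)) weight R s.

Lemma Gamma_walk_sum m l : Gamma R m l = walk_sum m l 0.
Proof. by apply: eq_bigl => s; rewrite position_size ?size_tuple. Qed.

Lemma walk_sum_odd m l : odd m || odd l -> walk_sum m l 0 = 0.
Proof.
move=> odd_ml; apply: big_pred0 => s; apply/negP => /andP[/eqP x0 /eqP tl].
by have [] := parity s; rewrite x0 tl size_tuple; move: odd_ml => /orP[] ->.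
Qed.

Lemma walk_sum0 l x : walk_sum 0 l x = ((x == 0) && (l == 0%N))%:R.
Proof.
rewrite /walk_sum big_mkcond (big_pred1 [tuple]) => [|s]; last by apply/esym/eqP; exact: tuple0.
rewrite /endpoint big_nil /weight /= big_nil eq_sym [_ == l]eq_sym.
by case: ifP.
Qed.

(** Multiplication by t^e on coefficients; the guard is there because subtraction truncates at 0. *)
Definition delayed (e : bool) (W : nat -> 'M[R]_2) l : 'M[R]_2 :=
  if (e <= l)%N then W (l - e)%N else 0.

Lemma rcons_tuple_bij m : bijective
  (fun p : bool * m.-tuple bool => [tuple of rcons p.2 p.1]).
Proof.
apply: inj_card_bij => [[b s] [b' s'] /(congr1 val) /= /rcons_inj[]|].
  by move=> /val_inj -> ->.
by rewrite card_prod !card_tuple card_bool expnS.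
Qed.

(** A last step to the left uses the edge {x, x + 1}, one to the right the edge {x - 1, x}; the sign
    of the left end decides whether t is gained. *)
Lemma walk_sumS m l x : walk_sum m.+1 l x =
  hadamardP R *m delayed (0 <= x) (walk_sum m ^~ (x + 1)) l +
  hadamardQ R *m delayed (0 <= x - 1) (walk_sum m ^~ (x - 1)) l.
Proof.
have walk_last (b : bool) : \sum_(s : m.-tuple bool |
      (endpoint (rcons s b) == x) && (time_right (rcons s b) == l))
      weight R (rcons s b) =
    (if b then hadamardQ R else hadamardP R) *m
    delayed (0 <= x - (b : nat)%:Z) (walk_sum m ^~ (x - move b)) l.
  rewrite /delayed /walk_sum; case: leqP => le_el.
    rewrite mulmx_sumr; apply: eq_big => [s|s _]; last exact: weight_rcons.
    rewrite endpoint_rcons time_right_rcons /move.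
    by move: le_el; case: b; lia.
  rewrite mulmx0 big_pred0 // => s.
  rewrite endpoint_rcons time_right_rcons /move.
  by move: le_el; case: b; lia.
rewrite /walk_sum (reindex _ (onW_bij _ (rcons_tuple_bij m))) /=.
transitivity (\sum_(b : bool) \sum_(s : m.-tuple bool |
  (endpoint (rcons s b) == x) && (time_right (rcons s b) == l)) weight R (rcons s b)).
  by rewrite pair_big_dep.
by rewrite big_bool !walk_last /= subr0 opprK addrC.
Qed.

Lemma mulPmx p (V : 'M[R]_(2, p)) j : (hadamardP R *m V) 0 j = q * (V 0 j + V 1 j) /\
  (hadamardP R *m V) 1 j = 0.
Proof.
have E : lift ord0 ord0 = 1 :> 'I_2 by apply/val_inj.
by split; rewrite !mxE !big_ord_recl big_ord0 !mxE /= E; ring.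
Qed.

Lemma mulQmx p (V : 'M[R]_(2, p)) j : (hadamardQ R *m V) 0 j = 0 /\
  (hadamardQ R *m V) 1 j = q * (V 0 j - V 1 j).
Proof.
have E : lift ord0 ord0 = 1 :> 'I_2 by apply/val_inj.
by split; rewrite !mxE !big_ord_recl big_ord0 !mxE /= E; ring.
Qed.

(** * Generating series and uniqueness for the recursion *)

Notation z := (fps_X {fps R}).
Notation t := (fps_const (fps_X R)).

(* [e] tells whether the step is made to the right of the origin. *)
Definition step (e : bool) : {fps {fps R}} :=
  fps_const (fps_const q) * (z * (if e then t else 1)).

Lemma coef_step e f m l : (step e * f) m l =
  if m is k.+1 then q * (if (e <= l)%N then f k (l - e)%N else 0) else 0.
Proof.
rewrite /step -!mulrA !coef_fpsCM coef_fpsXM.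
case: m => [|m]; first by rewrite coef_fps0 mulr0.
congr (_ * _); case: e; rewrite ?mul1r ?subn0 // coef_fpsCM coef_fpsXM.
by case: l => // l; rewrite subn1.
Qed.

(** By induction on m for all l and x, since [step] carries a factor z. A basis vector [c] selects
    one column of G_x. *)
Lemma walk_recursion_unique (c : 'cV[R]_2) (a b : int -> {fps {fps R}}) :
    (forall x, a x = (x == 0)%:R * fps_const (fps_const (c 0 0)) +
       step (0 <= x) * (a (x + 1) + b (x + 1))) ->
    (forall x, b x = (x == 0)%:R * fps_const (fps_const (c 1 0)) +
       step (0 <= x - 1) * (a (x - 1) - b (x - 1))) ->
  forall m l x, a x m l = (walk_sum m l x *m c) 0 0 /\
                b x m l = (walk_sum m l x *m c) 1 0.
Proof.
move=> aE bE; elim=> [|m IHm] l x; rewrite [a x]aE [b x]bE !coef_fpsD !coef_step.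
  rewrite walk_sum0 !addr0.
  case: eqP => _; last by rewrite mulr0n !mul0r mul0mx !mxE !coef_fps0.
  rewrite mulr1n !mul1r /=.
  by case: eqP => _; rewrite ?mul1mx ?mul0mx ?mxE.
have src y : ((x == 0)%:R * fps_const (fps_const y) : {fps {fps R}}) m.+1 l = 0.
  by case: eqP => _; rewrite ?mulr1n ?mul1r ?mulr0n ?mul0r ?coef_fps0.
rewrite !src !add0r walk_sumS mulmxDl -!mulmxA ![fun_of_matrix (_ + _) _ _]mxE.
set V := delayed (0 <= x) _ l *m c; set V' := delayed (0 <= x - 1) _ l *m c.
have [[-> ->] [-> ->]] := (mulPmx _ V 0, mulQmx _ V' 0).
rewrite addr0 add0r /V /V' /delayed; split; congr (_ * _).
  case: ifP => _; last by rewrite mul0mx !mxE addr0.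
  by rewrite !coef_fpsD; have [-> ->] := IHm (l - (0 <= x)%R)%N (x + 1).
case: ifP => _; last by rewrite mul0mx !mxE subr0.
by rewrite !coef_fpsD !coef_fpsN; have [-> ->] := IHm (l - (0 <= x - 1)%R)%N (x - 1).
Qed.


(** At m = 0 only the empty path is lost, of weight the identity; at odd m or l the sums over closed
    paths vanish anyway. *)
Lemma Gammabar_entry i j (g : {fps {fps R}}) :
    (forall m l, g m l = walk_sum m l 0 i j) ->
  Gammabar R i j = g - (i == j)%:R.
Proof.
move=> gE; rewrite mxE; apply/fpsP => m; apply/fpsP => l.
transitivity (walk_sum m l 0 i j - ((m == 0%N) && (l == 0%N) && (i == j))%:R); last first.
  rewrite -gE -(fps_const_natr _ (nat_of_bool (i == j))) -fps_const_natr.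
  by case: m l => [|m] [|l].
rewrite /=; case: m => [|m].
  by rewrite walk_sum0 eqxx /=; case: eqP => _; rewrite mxE subrr.
rewrite subr0 Gamma_walk_sum -negb_or; case: ifP => // /negbFE odd_ml.
by rewrite walk_sum_odd ?mxE.
Qed.

End Walk.

(** * Explicit solution of the recursion *)

Lemma walk_recursion_solution (K : comUnitRingType) (r s v w A B x0 y0 : K) :
    2 * r ^+ 2 = v -> 2 * s ^+ 2 = w ->
    let C := -1 - (v - A) * (w - B) in
    let D := 1 + v - A in let E := 1 + w - B in
    A ^+ 2 = 1 + v ^+ 2 -> B ^+ 2 = 1 + w ^+ 2 ->
    1 + v + A \is a GRing.unit -> 1 - v + A \is a GRing.unit ->
    1 + w + B \is a GRing.unit -> 1 - w + B \is a GRing.unit ->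
    C \is a GRing.unit -> (2 : K) \is a GRing.unit ->
  exists a b : int -> K, [/\
    forall x, a x = (x == 0)%:R * x0 + (if 0 <= x then s else r) * (a (x + 1) + b (x + 1)),
    forall x, b x = (x == 0)%:R * y0 + (if 0 <= x - 1 then s else r) * (a (x - 1) - b (x - 1)),
    a 0 = - C^-1 * ((2 - D) * x0 - E * y0) &
    b 0 = - C^-1 * (D * x0 + (2 - E) * y0)].
Proof.
move=> <- <- C D E AA BB uA vA uB vB uC u2.
have [l [p [lE pE spE]]] := half_line _ _ _ BB uB vB.
have [k [o [kE oE roE]]] := half_line _ _ _ AA uA vA.
(* The left half-line obeys the equations of the right one for the ratio - k. *)
pose a0 := - C^-1 * ((2 - D) * x0 - E * y0).
pose b0 := - C^-1 * (D * x0 + (2 - E) * y0).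
(* [c] is a_1 + b_1 and [c'] is a_{-1} - b_{-1}: the equations b_1 = s (a_0 - b_0) and a_{-1} = r
   (a_0 + b_0) give them through [p] and [o]. *)
pose c := p * (a0 - b0); pose c' := o * (a0 + b0).
pose a (x : int) := match x with
  | Posz 0 => a0 | Posz n.+1 => s * l * l ^+ n * c
  | Negz n => (1 - r * k) * (- k) ^+ n * c' end.
pose b (x : int) := match x with
  | Posz 0 => b0 | Posz n.+1 => (1 - s * l) * l ^+ n * c
  | Negz n => - (r * k) * (- k) ^+ n * c' end.
(* The left side is the determinant of the doubled system at x = 0: (2 - E) a_0 + E b_0 = 2 x0 and -
   D a_0 + (2 - D) b_0 = 2 y0, which [a0] and [b0] solve by Cramer's rule. *)
have CE : 4 - 2 * E - 2 * D + 2 * D * E = - 2 * C by rewrite /C /D /E; ring.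
have a0E : a0 = x0 + s * c.
  apply: (mulrI u2); rewrite mulrDr (_ : 2 * (s * c) = E * (a0 - b0)); last by rewrite /c /E -spE; ring.
  apply/eqP; rewrite -subr_eq0; apply/eqP.
  transitivity (- (C^-1 * (4 - 2 * E - 2 * D + 2 * D * E) + 2) * x0); first by rewrite /a0 /b0; ring.
  by rewrite CE mulrCA mulVr //; ring.
have b0E : b0 = y0 + r * c'.
  apply: (mulrI u2); rewrite mulrDr (_ : 2 * (r * c') = D * (a0 + b0)); last by rewrite /c' /D -roE; ring.
  apply/eqP; rewrite -subr_eq0; apply/eqP.
  transitivity (- (C^-1 * (4 - 2 * E - 2 * D + 2 * D * E) + 2) * y0); first by rewrite /a0 /b0; ring.
  by rewrite CE mulrCA mulVr //; ring.
have [PS NS N0] : [/\ forall n : nat, n%:Z + 1 = n.+1,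
    forall n : nat, Negz n.+1 + 1 = Negz n & Negz 0 + 1 = 0] by split; lia.
have [PP NP] : (forall n : nat, n.+1%:Z - 1 = n) /\
  (forall n : nat, Negz n - 1 = Negz n.+1) by split; lia.
(* For a at x >= 1 and b at x < 0 the geometric form suffices. For a at x = -1 and b at x = 1 the
   factors [o] and [p] enter; farther out, the quadratic equations [kE] and [lE]. *)
exists a, b; split=> //; case=> [[|n]|n].
- by rewrite PS /= !mulr1n mul1r a0E; ring.
- by rewrite PS /= !mulr0n mul0r exprS; ring.
- case: n => [|n]; rewrite ?N0 ?NS /= !mulr0n mul0r.
    by rewrite /c' -[in RHS]oE; ring.
  transitivity (- (k * (1 - r * k)) * (- k) ^+ n * c'); first by rewrite exprS; ring.
  by rewrite kE; ring.
- by rewrite sub0r /= !mulr1n mul1r b0E; ring.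
- rewrite PP; case: n => [|n] /=; rewrite !mulr0n mul0r.
    by rewrite /c -[in RHS]pE; ring.
  transitivity ((l * (1 - s * l)) * l ^+ n * c); first by rewrite exprS; ring.
  by rewrite lE; ring.
- by rewrite NP /= !mulr0n mul0r exprS; ring.
Qed.

Lemma mx2E (S : Type) (a b c d : S) i j : mx2 a b c d i j =
  if i == 0 then (if j == 0 then a else b) else (if j == 0 then c else d).
Proof. exact: mxE. Qed.

(** * The closed formula *)

Theorem theorem3p2 (R : rcfType) :
  let z : {fps {fps R}} := fps_X _ in
  let t : {fps {fps R}} := fps_const (fps_X R) in
  let A := fps2_sqrt (1 + z ^+ 4) in
  let B := fps2_sqrt (1 + z ^+ 4 * t ^+ 4) in
  let C := -1 - (z ^+ 2 - A) * (z ^+ 2 * t ^+ 2 - B) in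
  C \is a GRing.unit /\
  Gammabar R =
    C^-1 *: mx2
      ((z ^+ 2 - A) * (1 + z ^+ 2 * t ^+ 2 - B))
      (1 + z ^+ 2 * t ^+ 2 - B)
      (-1 - z ^+ 2 + A)
      (- ((-1 - z ^+ 2 + A) * (z ^+ 2 * t ^+ 2 - B))).
Proof.
move=> z t A B C.
have n2 : 2%:R != 0 :> R by rewrite pnatr_eq0.
have z0 f : (z * f) 0%N = 0 by rewrite coef_fpsXM.
have z00 f : (z * f) 0%N 0%N = 0 by rewrite z0 coef_fps0.
have [AA A0] : A ^+ 2 = 1 + z ^+ 4 /\ A 0%N 0%N = 1.
  by apply: fps2_sqrtP => //; rewrite coef_fpsD exprS z0 addr0.
have [BB B0] : B ^+ 2 = 1 + z ^+ 4 * t ^+ 4 /\ B 0%N 0%N = 1.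
  by apply: fps2_sqrtP => //; rewrite coef_fpsD exprS -mulrA z0 addr0.
pose q := fps_const (fps_const (Num.sqrt 2 : R)^-1).
have qq : 2 * q ^+ 2 = 1.
  rewrite /q -!fps_constX exprVn sqr_sqrtr ?ler0n //.
  by rewrite -(fps_const_natr _ 2) -fps_const_natr -!fps_constM divff.
have rE : 2 * step R false ^+ 2 = z ^+ 2.
  by rewrite /step -/z -/q mulr1 exprMn mulrA qq mul1r.
have sE : 2 * step R true ^+ 2 = z ^+ 2 * t ^+ 2.
  by rewrite /step -/z -/t -/q exprMn mulrA qq mul1r exprMn.
have coef1 : (1 : {fps {fps R}}) 0%N 0%N = 1 by [].
have zz f : (z ^+ 2 * f) 0%N 0%N = 0 by rewrite expr2 -mulrA z00.
have zz1 : (z ^+ 2) 0%N 0%N = 0 by rewrite expr2 z00.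
(* The constant term of [C] is -1 - (-1)(-1) = -2. *)
have uC : C \is a GRing.unit.
  have coefD (S T : {fps {fps R}}) : (S + T) 0%N 0%N = S 0%N 0%N + T 0%N 0%N by [].
  have coefN (S : {fps {fps R}}) : (- S) 0%N 0%N = - S 0%N 0%N by [].
  have coefM (S T : {fps {fps R}}) : (S * T) 0%N 0%N = S 0%N 0%N * T 0%N 0%N.
    by rewrite !coef0_fpsM.
  have unitN1 (S T : {fps {fps R}}) : S 0%N 0%N = -1 -> T 0%N 0%N = -1 ->
      -1 - S * T \is a GRing.unit.
    move=> S0 T0; apply: fps2_unit_coef00; rewrite coefD !coefN coefM S0 T0 coef1.
    by rewrite mulrNN mulr1 -opprD oppr_eq0.
  apply: unitN1; first by rewrite coefD zz1 coefN A0 sub0r.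
  by rewrite coefD zz coefN B0 sub0r.
split=> //.
have unit2 : (2 : {fps {fps R}}) \is a GRing.unit.
  by apply: fps2_unit_coef00; rewrite -(fps_const_natr _ 2) -fps_const_natr.
have unitAB (s S : {fps {fps R}}) : s 0%N 0%N = 0 -> S 0%N 0%N = 1 ->
    (1 + s + S \is a GRing.unit) && (1 - s + S \is a GRing.unit).
  move=> s0 S0; apply/andP; split; apply: fps2_unit_coef00;
    by rewrite !coef_fpsD ?coef_fpsN s0 S0 ?subr0 ?addr0.
have /andP[uA vA] := unitAB (z ^+ 2) A zz1 A0.
have /andP[uB vB] := unitAB (z ^+ 2 * t ^+ 2) B (zz _) B0.
have AA' : A ^+ 2 = 1 + (z ^+ 2) ^+ 2 by rewrite -exprM.
have BB' : B ^+ 2 = 1 + (z ^+ 2 * t ^+ 2) ^+ 2 by rewrite exprMn -!exprM.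
(* The recursion started from the j-th basis vector yields column j of G_0 = 1 + [Gammabar]. *)
have columns (j : 'I_2) (D := 1 + z ^+ 2 - A) (E := 1 + z ^+ 2 * t ^+ 2 - B) :
    Gammabar R 0 j = - C^-1 * ((2 - D) * (0 == j)%:R - E * (1 == j)%:R) - (0 == j)%:R /\
    Gammabar R 1 j = - C^-1 * (D * (0 == j)%:R + (2 - E) * (1 == j)%:R) - (1 == j)%:R.
  have [a [b [aE bE a0 b0]]] := walk_recursion_solution _ _ _ _ _ _ _
    (0 == j)%:R (1 == j)%:R rE sE AA' BB' uA vA uB vB uC unit2.
  have natE i : (i == j)%:R =
      fps_const (fps_const ((delta_mx j 0 : 'cV[R]_2) i 0)) :> {fps {fps R}}.
    by rewrite mxE eqxx andbT !fps_const_natr.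
  have walkE i (V : 'M[R]_2) : (V *m (delta_mx j 0 : 'cV[R]_2)) i 0 = V i j.
    by rewrite -colE mxE.
  have stepE e : step R e = if e then step R true else step R false.
    by case: e; exact: erefl.
  have abE m l : a 0 m l = walk_sum R m l 0 0 j /\ b 0 m l = walk_sum R m l 0 1 j.
    rewrite -!walkE; apply: walk_recursion_unique => x; rewrite -natE stepE.
      exact: aE.
    exact: bE.
  by rewrite -a0 -b0; split; apply: Gammabar_entry => m l; have [] := abE m l.
apply/matrixP => i j; rewrite [RHS]mxE mx2E.
have I2 (k : 'I_2) : k = 0 \/ k = 1.
  by case: k => [[|[|[]]]] // ?; [left|right]; apply/val_inj.
have [col0 col1] := columns j.
(* Writing the subtracted diagonal 1 as [C^-1 * C] turns each entry into a polynomial identity with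
   [C^-1] as an indeterminate. *)
have VC := mulVr uC.
set Ci := C^-1 in col0 col1 VC *; rewrite /C in VC.
by case: (I2 i) col0 col1 => -> col0 col1; [rewrite col0|rewrite col1];
  case: (I2 j) => -> /=; rewrite ?mulr1n ?mulr0n -?[X in _ - X]VC; ring.
Qed.
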